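(* Let $N$ be a surface (real dimension $2$) isometrically immersed in an almost Hermitian manifold $(M,g,J)$. Then the following three statements are equivalent: (1) $N$ is neither totally real nor complex in $M$, and $\nabla P=0$, that is, $P$ is parallel; (2) $N$ is a Kaehlerian slant surface; (3) $N$ is a proper slant surface.
   Context: Manifolds are smooth and connected. For $X$ tangent to $N$ write $JX=PX+FX$, with $PX$ tangent and $FX$ normal to $N$; thus $P$ is an endomorphism of $TN$. $\nabla$ is the Levi-Civita connection of $N$ and $(\nabla_XP)Y=\nabla_X(PY)-P(\nabla_XY)$. For nonzero $X\in T_xN$, the Wirtinger angle $\theta(X)\in[0,\pi/2]$ is the angle between $JX$ and the subspace $T_xN$. $N$ is slant if $\theta(X)$ is a constant independent of $x\in N$ and of nonzero $X\in T_xN$ (this constant is the slant angle). $N$ is complex if $\theta\equiv 0$ (i.e. $J(T_xN)\subseteq T_xN$ for all $x$), totally real if $\theta\equiv\pi/2$ (i.e. $J(T_xN)\subseteq T_x^\perp N$ for all $x$). A slant submanifold is proper if it is neither complex nor totally real. A Kaehlerian slant submanifold is a proper slant submanifold with $\nabla P=0$. *)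

(* Defs.v *)
From HB Require Import structures.
From mathcomp Require Import all_boot all_order all_algebra.
From mathcomp Require Import all_classical all_reals all_analysis.
Set Implicit Arguments.
Unset Strict Implicit.
Unset Printing Implicit Defensive.
Import Order.TTheory GRing.Theory Num.Theory.
Import numFieldNormedType.Exports.
Local Open Scope classical_set_scope.
Local Open Scope ring_scope.

(** * Smooth maps between finite-dimensional normed spaces *)

(* C^k in the Frechet sense; in finite dimension, continuity of every
   directional derivative amounts to continuity of the differential.  Only
   meant for U open. *)
Fixpoint Ck_on (R : realType) (V W : normedModType R) (k : nat) (U : set V)
    (f : V -> W) : Prop :=
  if k is k'.+1 then
    (forall u, U u -> differentiable f u) /\
    (forall v : V, Ck_on k' U (fun u => 'D_v f u))
  else forall u, U u -> {for u, continuous f}.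

Definition smooth_on (R : realType) (V W : normedModType R) (U : set V)
    (f : V -> W) : Prop :=
  forall k, Ck_on k U f.

(** * Smooth connected manifolds *)

(* [to_coord] and [of_coord] are relevant only on [chart_dom] and
   [chart_cod] respectively. *)
Record chart (R : realType) (n : nat) (T : topologicalType) := Chart {
  chart_dom : set T;
  to_coord : T -> 'rV[R]_n;
  of_coord : 'rV[R]_n -> T;
  chart_cod := to_coord @` chart_dom;
  open_chart_dom : open chart_dom;
  open_chart_cod : open chart_cod;
  to_coordK : forall x, chart_dom x -> of_coord (to_coord x) = x;
  continuous_to_coord : forall x, chart_dom x -> {for x, continuous to_coord};
  continuous_of_coord : forall u, chart_cod u -> {for u, continuous of_coord}
}.

(* The atlas need not be maximal.  The preferred charts [chart_at] carry no
   geometric content: they only serve to represent tangent vectors, see below. *)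
Record manifold (R : realType) (n : nat) := Manifold {
  carrier :> topologicalType;
  atlas : set (chart R n carrier);
  chart_at : carrier -> chart R n carrier;
  manifold_hausdorff : hausdorff_space carrier;
  manifold_second_countable : @second_countable carrier;
  manifold_connected : connected [set: carrier];
  chart_at_atlas : forall x, atlas (chart_at x);
  chart_at_dom : forall x, chart_dom (chart_at x) x;
  smooth_transition : forall c d, atlas c -> atlas d ->
    smooth_on (to_coord c @` (chart_dom c `&` chart_dom d))
              (to_coord d \o of_coord c)
}.

Section Calculus.
Variables (R : realType) (n : nat) (N : manifold R n).

(* The tangent space T_x N is 'rV[R]_n, a tangent vector being represented by
   its components in the preferred chart at x.  Endomorphisms of T_x N and
   linear maps out of it are matrices acting on row vectors from the right, and
   bilinear forms are Gram matrices.  A vector field is a map N -> 'rV[R]_n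
   whose value at x is read in T_x N. *)

(* v *m tangent_coord c x is the component vector of v : T_x N in the chart c;
   the rows of coord_frame c x are the coordinate vector fields of c at x. *)
Definition tangent_coord (c : chart R n N) (x : N) : 'M[R]_n :=
  'J (to_coord c \o of_coord (chart_at x)) (to_coord (chart_at x) x).

Definition coord_frame (c : chart R n N) (x : N) : 'M[R]_n :=
  'J (to_coord (chart_at x) \o of_coord c) (to_coord c x).

Definition smooth_fun (U : set N) (h : N -> R) : Prop :=
  forall c, atlas c ->
    smooth_on (to_coord c @` (chart_dom c `&` U)) (h \o of_coord c : _ -> R^o).

Definition smooth_field (U : set N) (X : N -> 'rV[R]_n) : Prop :=
  forall c, atlas c ->
    smooth_on (to_coord c @` (chart_dom c `&` U))
              ((fun x => X x *m tangent_coord c x) \o of_coord c).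

Definition smooth_bilinear (g : N -> 'M[R]_n) : Prop :=
  forall c, atlas c ->
    smooth_on (chart_cod c)
      ((fun x => coord_frame c x *m g x *m (coord_frame c x)^T) \o of_coord c).

Definition smooth_endo (A : N -> 'M[R]_n) : Prop :=
  forall c, atlas c ->
    smooth_on (chart_cod c)
      ((fun x => coord_frame c x *m A x *m tangent_coord c x) \o of_coord c).

(* the derivative v(h) of h at x along v : T_x N *)
Definition dir_derive (h : N -> R) (x : N) (v : 'rV[R]_n) : R :=
  'D_v (h \o of_coord (chart_at x) : _ -> R^o) (to_coord (chart_at x) x).

End Calculus.

Section SmoothMaps.
Variables (R : realType) (n m : nat) (N : manifold R n) (M : manifold R m).

Definition smooth_map (f : N -> M) : Prop :=
  continuous f /\
  forall c d, atlas c -> atlas d ->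
    smooth_on (to_coord c @` (chart_dom c `&` f @^-1` chart_dom d))
              (to_coord d \o f \o of_coord c).

(* the differential T_x N -> T_(f x) M *)
Definition dmap (f : N -> M) (x : N) : 'M[R]_(n, m) :=
  'J (to_coord (chart_at (f x)) \o f \o of_coord (chart_at x))
     (to_coord (chart_at x) x).

Definition immersion (f : N -> M) : Prop :=
  smooth_map f /\ forall x, row_free (dmap f x).

End SmoothMaps.

(** * Inner products and angles *)

Section Angles.
Variables (R : realType) (m : nat) (G : 'M[R]_m).

Definition inner (u v : 'rV[R]_m) : R := (u *m G *m v^T) 0 0.

Definition inner_norm (u : 'rV[R]_m) : R := Num.sqrt (inner u u).

Definition vangle (u v : 'rV[R]_m) : R :=
  acos (inner u v / (inner_norm u * inner_norm v)).

(* the angle between u and the subspace spanned by the rows of A: the least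
   angle between u and a nonzero vector of that subspace *)
Definition angle_subspace (k : nat) (u : 'rV[R]_m) (A : 'M[R]_(k, m)) : R :=
  inf [set vangle u w | w in [set w | (w <= A)%MS /\ w != 0]].

End Angles.

(** * Riemannian and almost Hermitian structures *)

Section Structures.
Variables (R : realType) (n : nat) (N : manifold R n).

Definition riemannian_metric (g : N -> 'M[R]_n) : Prop :=
  [/\ smooth_bilinear g,
      forall x, (g x)^T = g x
    & forall x v, v != 0 -> 0 < inner (g x) v v].

Definition almost_complex_structure (J : N -> 'M[R]_n) : Prop :=
  smooth_endo J /\ forall x, J x *m J x = - 1%:M.

Definition almost_hermitian (g J : N -> 'M[R]_n) : Prop :=
  [/\ riemannian_metric g,
      almost_complex_structure J
    & forall x u v, inner (g x) (u *m J x) (v *m J x) = inner (g x) u v].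

(* nabla Y x v stands for the value at x of the covariant derivative of Y along
   v : T_x N.  A connection is a local operator, so it is made to act on fields
   that are smooth only on some open set U, at the points x of U; its values on
   other arguments are irrelevant.  Locality need not be postulated: it follows
   from Leibniz's rule applied to h := the indicator function of U.
   Torsion-freeness, nabla_X Y - nabla_Y X = [X, Y], is tested on smooth
   functions h, with [X, Y] h = X (Y h) - Y (X h). *)
Record levi_civita (g : N -> 'M[R]_n)
    (nabla : (N -> 'rV[R]_n) -> N -> 'rV[R]_n -> 'rV[R]_n) : Prop := LeviCivita {
  nabla_smooth : forall U X Y, open U -> smooth_field U X -> smooth_field U Y ->
    smooth_field U (fun x => nabla Y x (X x));
  nabla_linear : forall U Y x, open U -> smooth_field U Y -> U x ->
    forall a v w, nabla Y x (a *: v + w) = a *: nabla Y x v + nabla Y x w;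
  nablaD : forall U Y Z x, open U -> smooth_field U Y -> smooth_field U Z ->
    U x -> forall v,
    nabla (fun y => Y y + Z y) x v = nabla Y x v + nabla Z x v;
  nabla_leibniz : forall U h Y x, open U -> smooth_fun U h ->
    smooth_field U Y -> U x -> forall v,
    nabla (fun y => h y *: Y y) x v =
      dir_derive h x v *: Y x + h x *: nabla Y x v;
  nabla_metric : forall U Y Z x, open U -> smooth_field U Y ->
    smooth_field U Z -> U x -> forall v,
    dir_derive (fun y => inner (g y) (Y y) (Z y)) x v =
      inner (g x) (nabla Y x v) (Z x) + inner (g x) (Y x) (nabla Z x v);
  nabla_torsion_free : forall U X Y h x, open U -> smooth_field U X ->
    smooth_field U Y -> smooth_fun U h -> U x ->
    dir_derive h x (nabla Y x (X x) - nabla X x (Y x)) =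
      dir_derive (fun y => dir_derive h y (Y y)) x (X x)
      - dir_derive (fun y => dir_derive h y (X y)) x (Y x)
}.

(* the value (nabla_v P) Y at x *)
Definition nabla_endo (nabla : (N -> 'rV[R]_n) -> N -> 'rV[R]_n -> 'rV[R]_n)
    (P : N -> 'M[R]_n) (x : N) (v : 'rV[R]_n) (Y : N -> 'rV[R]_n) : 'rV[R]_n :=
  nabla (fun y => Y y *m P y) x v - nabla Y x v *m P x.

Definition parallel (nabla : (N -> 'rV[R]_n) -> N -> 'rV[R]_n -> 'rV[R]_n)
    (P : N -> 'M[R]_n) : Prop :=
  forall U Y x, open U -> smooth_field U Y -> U x ->
    forall v, nabla_endo nabla P x v Y = 0.

End Structures.

(** * Submanifolds of almost Hermitian manifolds *)

Section Submanifolds.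
Variables (R : realType) (n m : nat) (N : manifold R n) (M : manifold R m).
Variables (g J : M -> 'M[R]_m) (f : N -> M).

Definition isometric_immersion (gN : N -> 'M[R]_n) : Prop :=
  immersion f /\
  forall x v w, inner (g (f x)) (v *m dmap f x) (w *m dmap f x) =
                inner (gN x) v w.

(* J X = P X + F X for X tangent to N, with P X tangent and F X normal *)
Definition tangent_normal_decomposition (P : N -> 'M[R]_n)
    (F : N -> 'M[R]_(n, m)) : Prop :=
  forall x X,
    X *m dmap f x *m J (f x) = X *m P x *m dmap f x + X *m F x /\
    forall Y, inner (g (f x)) (X *m F x) (Y *m dmap f x) = 0.

Definition wirtinger_angle (x : N) (X : 'rV[R]_n) : R :=
  angle_subspace (g (f x)) (X *m dmap f x *m J (f x)) (dmap f x).

Definition slant : Prop :=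
  exists theta, forall x X, X != 0 -> wirtinger_angle x X = theta.

Definition complex_submanifold : Prop :=
  forall x X, X != 0 -> wirtinger_angle x X = 0.

Definition totally_real : Prop :=
  forall x X, X != 0 -> wirtinger_angle x X = pi / 2.

Definition proper_slant : Prop :=
  [/\ slant, ~ complex_submanifold & ~ totally_real].

Definition kaehlerian_slant
    (nabla : (N -> 'rV[R]_n) -> N -> 'rV[R]_n -> 'rV[R]_n)
    (P : N -> 'M[R]_n) : Prop :=
  proper_slant /\ parallel nabla P.

End Submanifolds.

(* Main.v *)
(* On a surface the tangential part P of J is skew for the induced metric, so
   P^2 = - det P and |PX| = sqrt (det P) |X|: the Wirtinger angle of every
   nonzero X at x is acos (sqrt (det (P x))), whence N is slant iff det P is
   constant.  For a local field Y, differentiating <PY, Y> = 0 shows that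
   (nabla_v P) Y is orthogonal to Y, and differentiating
   <PY, PY> = (det P) <Y, Y> gives
   2 <(nabla_v P) Y, PY> = v(det P) |Y|^2.
   If P is parallel, then v(det P) = 0 for all v, and det P is constant by
   connectedness.  Conversely, if det P is a nonzero constant, then
   (nabla_v P) Y is orthogonal to the basis (Y, PY) wherever Y does not vanish,
   hence is 0 there; zeros of Y are handled by adding a nonvanishing field.
   Smoothness of P, needed to differentiate PY, follows from the matrix formula
   P gN = df J g df^T read in charts. *)
Require Import Defs.
From HB Require Import structures.
From mathcomp Require Import all_boot all_order all_algebra.
From mathcomp Require Import all_classical all_reals all_analysis.
From mathcomp Require Import ring lra.
Import Order.TTheory GRing.Theory Num.Theory.
Import numFieldNormedType.Exports.
Local Open Scope classical_set_scope.
Local Open Scope ring_scope.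

Set Implicit Arguments.
Unset Strict Implicit.
Unset Printing Implicit Defensive.

(** * Calculus of C^k maps *)

Section CkFunctions.
Variables (R : realType) (V : normedModType R).

(** The first-order expansion of [f] at [x] only involves points near [x], so it is also an
    expansion of [g]; uniqueness of the differential then identifies ['d g x] with ['d f x]. *)
Lemma near_eq_differentiable (W : normedModType R) (f g : V -> W) (x : V) :
  (\near x, f x = g x) -> differentiable f x -> differentiable g x.
Proof.
move=> fg df.
have gE : g \o shift x = cst (g x) + 'd f x +o_ 0 id.
  apply/eqaddoP => e e0.
  have /eqaddoP/(_ e e0) := diff_locally df.
  have : \forall h \near (0 : V), f (h + x) = g (h + x).
    by have := fg; rewrite (near_shift 0 x) /= subr0.
  apply: filterS2 => h fgh.
  by rewrite /= !fctE /= -fgh (nbhs_singleton fg).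
have dgE := diff_unique (diff_continuous df) gE.
apply/diff_locallyP; rewrite dgE; split=> //.
exact: diff_continuous.
Qed.

Lemma Ck_onS (W : normedModType R) k (U : set V) (f : V -> W) :
  Ck_on k.+1 U f -> Ck_on k U f.
Proof.
elim: k f => [|k IH] f /= [df Df].
  by move=> u Uu; apply: differentiable_continuous; exact: df.
by split=> // v; apply: IH; exact: Df.
Qed.

Lemma Ck_on_subset (W : normedModType R) k (A B : set V) (f : V -> W) :
  A `<=` B -> Ck_on k B f -> Ck_on k A f.
Proof.
move=> AB; elim: k f => [|k IH] f /=; first by move=> fc u /AB; exact: fc.
by move=> [df Df]; split=> [u /AB|v]; [exact: df|exact: IH].
Qed.

(** Regularity is tested on the total function [f] one point at a time, so any [A] through [u]
    serves. *)
Lemma Ck_on_local (W : normedModType R) k (U : set V) (f : V -> W) :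
  (forall u, U u -> exists2 A : set V, A u & Ck_on k A f) -> Ck_on k U f.
Proof.
elim: k f => [|k IH] f /= Uf; first by move=> u /Uf[A Au]; apply.
split=> [u /Uf[A Au []]|v]; first by move=> + _; apply.
by apply: IH => u /Uf[A Au [_ Df]]; exists A.
Qed.

(** As [U] is open, agreement on [U] is agreement near each of its points; the directional
    derivatives then agree on [U] too, which feeds the induction. *)
Lemma Ck_on_eq (W : normedModType R) k (U : set V) (f g : V -> W) :
  open U -> (forall u, U u -> f u = g u) -> Ck_on k U f -> Ck_on k U g.
Proof.
move=> oU; have Unear (u : V) (h h' : V -> W) : U u ->
    (forall z, U z -> h z = h' z) -> \near u, h u = h' u.
  move=> Uu hh'; have : nbhs u U by apply: open_nbhs_nbhs.
  exact: filterS.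
elim: k f g => [|k IH] f g fg /=.
  move=> fc u Uu; have : f x @[x --> u] --> g u by rewrite -fg//; exact: fc.
  by apply: cvg_trans; apply: near_eq_cvg; exact: Unear.
move=> [df Df]; split=> [u Uu|v].
  by apply: near_eq_differentiable (df u Uu); exact: Unear.
apply: IH (Df v) => u Uu; apply: near_eq_derive; exact: Unear.
Qed.

Lemma Ck_on_ext (W : normedModType R) k (U : set V) (f g : V -> W) :
  f =1 g -> Ck_on k U f -> Ck_on k U g.
Proof. by move=> /funext ->. Qed.

Lemma Ck_on_cst (W : normedModType R) k (U : set V) (a : W) :
  Ck_on k U (fun _ => a).
Proof.
elim: k a => [|k IH] a /=; first by move=> u _; exact: cst_continuous.
split=> [u _|v]; first exact: differentiable_cst.
by apply: Ck_on_ext (IH 0) => u; rewrite [RHS]derive_cst.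
Qed.

Lemma Ck_onD (W : normedModType R) k (U : set V) (f g : V -> W) : open U ->
  Ck_on k U f -> Ck_on k U g -> Ck_on k U (fun u => f u + g u).
Proof.
move=> oU; elim: k f g => [|k IH] f g /=.
  by move=> fc gc u Uu; apply: continuousD; [exact: fc|exact: gc].
move=> [df Df] [dg Dg]; split=> [u Uu|v].
  by apply: differentiableD; [exact: df|exact: dg].
apply: Ck_on_eq oU _ (IH _ _ (Df v) (Dg v)) => u Uu.
by rewrite -deriveD//; apply: diff_derivable; [exact: df|exact: dg].
Qed.

Lemma Ck_on_sum (W : normedModType R) k (U : set V) (I : Type) (r : seq I)
    (Q : pred I) (f : I -> V -> W) : open U ->
  (forall i, Ck_on k U (f i)) ->
  Ck_on k U (fun u => \sum_(i <- r | Q i) f i u).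
Proof.
move=> oU fk; elim: r => [|i r IH].
  by apply: Ck_on_ext (Ck_on_cst k U 0) => u; rewrite big_nil.
case Qi: (Q i); last by apply: Ck_on_ext IH => u; rewrite big_cons Qi.
by apply: Ck_on_ext (Ck_onD oU (fk i) IH) => u; rewrite big_cons Qi.
Qed.

(** Induction through the product rule; [Ck_onS] lowers the order of the factor that is not
    differentiated. *)
Lemma Ck_onM k (U : set V) (f g : V -> R^o) : open U ->
  Ck_on k U f -> Ck_on k U g -> Ck_on k U (fun u => f u * g u : R^o).
Proof.
move=> oU; elim: k f g => [|k IH] f g fk gk.
  by move=> u Uu; apply: continuousM; [exact: fk|exact: gk].
have [df Df] := fk; have [dg Dg] := gk.
split=> [u Uu|v]; first by apply: differentiableM; [exact: df|exact: dg].
apply: Ck_on_eq oU _ (Ck_onD oU (IH _ _ (Ck_onS fk) (Dg v))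
  (IH _ _ (Ck_onS gk) (Df v))) => u Uu.
have := @deriveM _ _ f g u v (diff_derivable (df u Uu)) (diff_derivable (dg u Uu)).
by move=> /esym.
Qed.

Lemma Ck_on_prod k (U : set V) (I : Type) (r : seq I) (Q : pred I)
    (f : I -> V -> R^o) : open U ->
  (forall i, Ck_on k U (f i)) ->
  Ck_on k U (fun u => \prod_(i <- r | Q i) f i u : R^o).
Proof.
move=> oU fk; elim: r => [|i r IH].
  by apply: Ck_on_ext (Ck_on_cst k U (1 : R^o)) => u; rewrite big_nil.
case Qi: (Q i); last by apply: Ck_on_ext IH => u; rewrite big_cons Qi.
by apply: Ck_on_ext (Ck_onM oU (fk i) IH) => u; rewrite big_cons Qi.
Qed.

(** Induction through [D_v (1/f) = - (1/f)^2 D_v f]. *)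
Lemma Ck_onV k (U : set V) (f : V -> R^o) : open U ->
  (forall u, U u -> f u != 0) -> Ck_on k U f -> Ck_on k U (fun u => (f u)^-1 : R^o).
Proof.
move=> oU f0; elim: k => [|k IH] fk.
  by move=> u Uu; apply: continuousV; [exact: f0|exact: fk].
have [df Df] := fk; split=> [u Uu|v].
  by apply: differentiableV; [exact: df|exact: f0].
have fVk := IH (Ck_onS fk).
apply: Ck_on_eq oU _ (Ck_onM oU (Ck_on_cst k U (-1 : R^o))
  (Ck_onM oU (Ck_onM oU fVk fVk) (Df v))) => u Uu.
rewrite (@deriveV _ _ f u v (f0 _ Uu) (diff_derivable (df u Uu))).
by rewrite mulN1r expr2 invfM scaleNr.
Qed.

Lemma differentiable_mx p q (A : V -> 'M[R]_(p, q)) u :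
  (forall i j, differentiable (fun u => A u i j : R^o) u) -> differentiable A u.
Proof.
move=> dA.
(* A combination of constant matrices with scalar coefficients reduces the claim to the entries. *)
rewrite (_ : A = \sum_(i < p) \sum_(j < q) (fun u => A u i j *: delta_mx i j)).
  do 2 (apply: differentiable_sum => ?).
  exact: differentiableZl.
apply/funext => z; rewrite [LHS]matrix_sum_delta fct_sumE.
by apply: eq_bigr => i _; rewrite fct_sumE.
Qed.

Lemma continuous_mx p q (A : V -> 'M[R]_(p, q)) u :
  (forall i j, {for u, continuous (fun u => A u i j : R^o)}) ->
  {for u, continuous A}.
Proof.
move=> cA; apply/cvgrPdist_le => /= e e0; near=> z.
(* The matrix norm is a maximum over finitely many entries, so finitely many neighbourhoods are
   intersected. *)
rewrite /Num.Def.normr/= mx_normrE (bigmax_le _ (ltW e0))//= => i _.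
rewrite !mxE/=; move: i; near: z; apply: filter_forall => /= i.
exact: ((cvgrPdist_le _ _).1 (cA i.1 i.2)).
Unshelve. all: by end_near. Qed.

Lemma Ck_on_mxP p q k (U : set V) (A : V -> 'M[R]_(p, q)) : open U ->
  Ck_on k U A <-> forall i j, Ck_on k U (fun u => A u i j : R^o).
Proof.
move=> oU; elim: k A => [|k IH] A; split.
- move=> cA i j u Uu; apply: (@continuous_comp _ _ _ A (fun B : 'M[R]_(p, q) => B i j)).
    exact: cA.
  exact: coord_continuous.
- by move=> cA u Uu; apply: continuous_mx => i j; exact: cA.
- move=> [dA DA] i j; split=> [u Uu|v].
    apply: (@differentiable_comp _ _ _ _ A (fun B : 'M[R]_(p, q) => B i j)).
      exact: dA.
    exact: differentiable_coord.
  have /IH/(_ i j) := DA v; apply: Ck_on_eq => // u Uu.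
  rewrite derive_mx ?mxE//; apply: diff_derivable; exact: dA.
- move=> cA; have dA u : U u -> differentiable A u.
    by move=> Uu; apply: differentiable_mx => i j; have [+ _] := cA i j; apply.
  split=> // v; apply/IH => i j; have [_ /(_ v)] := cA i j.
  apply: Ck_on_eq => // u Uu.
  rewrite derive_mx ?mxE//; apply: diff_derivable; exact: dA.
Qed.

End CkFunctions.

(** * Smooth maps: composition and matrix operations *)

Section SmoothFunctions.
Variables (R : realType) (V : normedModType R).

(** Expanding the direction ['D_v f u] in the standard basis leaves derivatives of [h] along fixed
    vectors. These are again functions composed with [f], so [Ck_on_comp] can proceed by induction
    on the order. *)
Lemma derive_comp_rV (W : normedModType R) n (f : V -> 'rV[R]_n)
    (h : 'rV[R]_n -> W) u v :
  differentiable f u -> differentiable h (f u) ->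
  'D_v (h \o f) u = \sum_j ('D_v f u) 0 j *: 'D_(delta_mx 0 j) h (f u).
Proof.
move=> df dh; rewrite deriveE; last exact: differentiable_comp.
rewrite diff_comp//= -(deriveE _ df) [in LHS](row_sum_delta ('D_v f u)) linear_sum.
by apply: eq_bigr => j _; rewrite linearZ/= (deriveE _ dh).
Qed.

Lemma Ck_on_comp n k (U : set V) (U' : set 'rV[R]_n) (f : V -> 'rV[R]_n)
    (h : 'rV[R]_n -> R^o) : open U -> (forall u, U u -> U' (f u)) ->
  Ck_on k U f -> Ck_on k U' h -> Ck_on k U (h \o f).
Proof.
move=> oU fU; elim: k h => [|k IH] h fk hk.
  by move=> u Uu; apply: continuous_comp; [exact: fk|exact/hk/fU].
have [df Df] := fk; have [dh Dh] := hk; split=> [u Uu|v].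
  by apply: differentiable_comp; [exact: df|exact/dh/fU].
have sk : Ck_on k U (fun u => \sum_j (('D_v f u) 0 j *
    ('D_(delta_mx 0 j) h \o f) u) : R^o).
  apply: Ck_on_sum => // j; apply: Ck_onM => //.
    exact: (Ck_on_mxP k _ oU).1 (Df v) 0 j.
  by apply: IH; [exact: Ck_onS|exact: Dh].
apply: Ck_on_eq oU _ sk => u Uu /=.
by rewrite derive_comp_rV//; [exact: df|exact/dh/fU].
Qed.

Lemma smooth_on_comp n p q (U : set V) (U' : set 'rV[R]_n) (f : V -> 'rV[R]_n)
    (h : 'rV[R]_n -> 'M[R]_(p, q)) : open U -> open U' ->
  (forall u, U u -> U' (f u)) ->
  smooth_on U f -> smooth_on U' h -> smooth_on U (h \o f).
Proof.
move=> oU oU' fU fs hs k; apply/Ck_on_mxP => // i j.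
apply: (Ck_on_comp (h := fun u => h u i j : R^o) oU fU) => //.
exact: (Ck_on_mxP k h oU').1 (hs k) i j.
Qed.

Lemma smooth_on_subset (W : normedModType R) (A B : set V) (f : V -> W) :
  A `<=` B -> smooth_on B f -> smooth_on A f.
Proof. by move=> AB fB k; exact: Ck_on_subset AB (fB k). Qed.

Lemma smooth_on_eq (W : normedModType R) (U : set V) (f h : V -> W) :
  open U -> (forall u, U u -> f u = h u) -> smooth_on U f -> smooth_on U h.
Proof. by move=> oU fh fU k; exact: Ck_on_eq oU fh (fU k). Qed.

Lemma smooth_on_local (W : normedModType R) (U : set V) (f : V -> W) :
  (forall u, U u -> exists2 A : set V, A u & smooth_on A f) -> smooth_on U f.
Proof.
move=> fU k; apply: Ck_on_local => u /fU[A Au fA].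
by exists A => //; exact: fA.
Qed.

Lemma smooth_on_cst (W : normedModType R) (U : set V) (a : W) :
  smooth_on U (fun _ => a).
Proof. by move=> k; exact: Ck_on_cst. Qed.

Lemma smooth_onM (U : set V) (f h : V -> R^o) : open U ->
  smooth_on U f -> smooth_on U h -> smooth_on U (fun u => f u * h u : R^o).
Proof. by move=> oU fU hU k; apply: Ck_onM oU (fU k) (hU k). Qed.

Lemma smooth_on_mxP p q (U : set V) (A : V -> 'M[R]_(p, q)) : open U ->
  smooth_on U A <-> forall i j, smooth_on U (fun u => A u i j : R^o).
Proof.
move=> oU; split=> [AU i j k|AU k]; first exact: (Ck_on_mxP k A oU).1 (AU k) i j.
by apply/Ck_on_mxP => // i j; exact: AU.
Qed.

Lemma smooth_on_mul p q r (U : set V) (A : V -> 'M[R]_(p, q))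
    (B : V -> 'M[R]_(q, r)) : open U ->
  smooth_on U A -> smooth_on U B -> smooth_on U (fun u => A u *m B u).
Proof.
move=> oU /smooth_on_mxP-/(_ oU) AU /smooth_on_mxP-/(_ oU) BU.
apply/smooth_on_mxP => // i j k.
have : Ck_on k U (fun u => \sum_l A u i l * B u l j : R^o).
  by apply: Ck_on_sum => // l; apply: Ck_onM => //; [exact: AU|exact: BU].
by apply: Ck_on_ext => u; rewrite mxE.
Qed.

Lemma smooth_on_scale p q (U : set V) (h : V -> R^o) (A : V -> 'M[R]_(p, q)) :
  open U -> smooth_on U h -> smooth_on U A ->
  smooth_on U (fun u => h u *: A u).
Proof.
move=> oU hU /smooth_on_mxP-/(_ oU) AU; apply/smooth_on_mxP => // i j.
by apply: smooth_on_eq (smooth_onM oU hU (AU i j)) => // u _; rewrite mxE.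
Qed.

Lemma smooth_on_tr p q (U : set V) (A : V -> 'M[R]_(p, q)) : open U ->
  smooth_on U A -> smooth_on U (fun u => (A u)^T).
Proof.
move=> oU /smooth_on_mxP-/(_ oU) AU; apply/smooth_on_mxP => // i j.
by apply: smooth_on_eq (AU j i) => // u _; rewrite mxE.
Qed.

Lemma smooth_on_det n (U : set V) (A : V -> 'M[R]_n) : open U ->
  smooth_on U A -> smooth_on U (fun u => \det (A u) : R^o).
Proof.
move=> oU /smooth_on_mxP-/(_ oU) AU k.
apply: Ck_on_sum => // s; apply: Ck_onM => //; first exact: Ck_on_cst.
by apply: Ck_on_prod => // i; exact: AU.
Qed.

(** Each entry is a signed minor, hence the determinant of a smooth matrix up to sign. *)
Lemma smooth_on_adj n (U : set V) (A : V -> 'M[R]_n) : open U ->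
  smooth_on U A -> smooth_on U (fun u => \adj (A u)).
Proof.
move=> oU /smooth_on_mxP-/(_ oU) AU; apply/smooth_on_mxP => // i j.
have : smooth_on U (fun u => cofactor (A u) j i : R^o).
  apply: smooth_onM => //; first exact: smooth_on_cst.
  apply: smooth_on_det => //; apply/smooth_on_mxP => // a b.
  by apply: smooth_on_eq (AU (lift j a) (lift i b)) => // u _; rewrite !mxE.
by apply: smooth_on_eq => // u _; rewrite mxE.
Qed.

(** Cramer's rule: the inverse is the adjugate divided by the determinant. *)
Lemma smooth_on_invmx n (U : set V) (A : V -> 'M[R]_n) : open U ->
  (forall u, U u -> A u \in unitmx) ->
  smooth_on U A -> smooth_on U (fun u => invmx (A u)).
Proof.
move=> oU Aunit AU.
have dV : smooth_on U (fun u => (\det (A u))^-1 : R^o).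
  move=> k; apply: Ck_onV => //; last exact: smooth_on_det.
  by move=> u /Aunit; rewrite unitmxE unitfE.
apply: smooth_on_eq (smooth_on_scale oU dV (smooth_on_adj oU AU)) => // u Uu.
by rewrite /invmx Aunit.
Qed.

Lemma smooth_on_differentiable (W : normedModType R) (U : set V) (f : V -> W) u :
  smooth_on U f -> U u -> differentiable f u.
Proof. by move=> /(_ 1%N)[+ _]; apply. Qed.

End SmoothFunctions.

(** * Jacobian matrices acting on row vectors *)

Section Jacobians.
Variable R : realType.

(** Row [i] is the derivative along the [i]-th basis vector. One order of differentiability is lost,
    so order [k.+1] of [f] is used to get order [k]. *)
Lemma smooth_on_jacobian n p (U : set 'rV[R]_n) (f : 'rV[R]_n -> 'rV[R]_p) :
  open U -> smooth_on U f -> smooth_on U (fun u => 'J f u).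
Proof.
move=> oU fU; apply/smooth_on_mxP => // i j k.
have [df Df] := fU k.+1.
have := (Ck_on_mxP k _ oU).1 (Df (delta_mx 0 i)) 0 j.
apply: Ck_on_eq => // u Uu.
by rewrite deriveEjacobian ?mul_delta_mx// -?rowE ?mxE//; exact: df.
Qed.

Lemma jacobian_comp n p q (f : 'rV[R]_n -> 'rV[R]_p) (h : 'rV[R]_p -> 'rV[R]_q)
    u : differentiable f u -> differentiable h (f u) ->
  'J (h \o f) u = 'J f u *m 'J h (f u).
Proof.
move=> df dh; apply/row_matrixP => i; rewrite !rowE mulmxA.
rewrite !mul_rV_lin1 diff_comp//=; by rewrite mul_rV_lin1.
Qed.

Lemma row_jacobian n p (f : 'rV[R]_n -> 'rV[R]_p) u i :
  differentiable f u -> row i ('J f u) = 'D_(delta_mx 0 i) f u.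
Proof. by move=> df; rewrite rowE deriveEjacobian. Qed.

Lemma near_eq_jacobian n p (f h : 'rV[R]_n -> 'rV[R]_p) u :
  differentiable f u -> (\near u, f u = h u) -> 'J f u = 'J h u.
Proof.
move=> df fh; have dh := near_eq_differentiable fh df.
apply/row_matrixP => i; apply: etrans (row_jacobian i df) _.
by apply: etrans (esym (row_jacobian i dh)); exact: near_eq_derive.
Qed.

Lemma jacobian_id n (u : 'rV[R]_n) : 'J id u = 1%:M.
Proof.
have did : differentiable (id : 'rV[R]_n -> 'rV[R]_n) u by [].
by apply/row_matrixP => i; apply: etrans (row_jacobian i did) _; rewrite derive_id row1.
Qed.

End Jacobians.

(* Comparing two Jacobians up to conversion would unfold both differentials. *)
Local Opaque jacobian.

(** * Changes of charts *)

Section Charts.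
Variables (R : realType) (n : nat) (N : manifold R n).
Implicit Types (c d e : chart R n N) (x : N) (U : set N).

(** The image is rewritten as a preimage under [of_coord c], whose openness follows from
    continuity. *)
Lemma image_chartE c U :
  to_coord c @` (chart_dom c `&` U) = chart_cod c `&` of_coord c @^-1` U.
Proof.
apply/seteqP; split=> [_ [x [cx Ux] <-]|_ [[x cx <-]]]; rewrite /= to_coordK//.
  by split=> //; exists x.
by move=> Ux; exists x.
Qed.

Lemma nbhs_chart_cod c u : chart_cod c u -> nbhs u (chart_cod c).
Proof. by move=> cu; apply: open_nbhs_nbhs; split=> //; exact: open_chart_cod. Qed.

Lemma open_image_chart c U : open U -> open (to_coord c @` (chart_dom c `&` U)).
Proof.
move=> oU; rewrite image_chartE openE => u [cu Uu].
have nU : nbhs u (of_coord c @^-1` U).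
  by apply: (continuous_of_coord cu); exact: open_nbhs_nbhs.
exact: filterI (nbhs_chart_cod cu) nU.
Qed.

Lemma jacobian_chain p q r (A : set 'rV[R]_p) (a : 'rV[R]_p -> 'rV[R]_q)
    (b : 'rV[R]_q -> 'rV[R]_r) (h : 'rV[R]_p -> 'rV[R]_r) u :
  open A -> A u -> (forall z, A z -> b (a z) = h z) ->
  differentiable a u -> differentiable b (a u) ->
  'J h u = 'J a u *m 'J b (a u).
Proof.
move=> oA Au bah da db; apply: etrans _ (jacobian_comp da db).
apply/esym/near_eq_jacobian; first exact: differentiable_comp.
by apply: filterS (open_nbhs_nbhs (conj oA Au)).
Qed.

Lemma transition_differentiable c d x : atlas c -> atlas d ->
  chart_dom c x -> chart_dom d x ->
  differentiable (to_coord d \o of_coord c) (to_coord c x).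
Proof.
move=> ac ad cx dx; apply: smooth_on_differentiable (smooth_transition ac ad) _.
by exists x.
Qed.

Lemma transition_jacobian c d e x : atlas c -> atlas d -> atlas e ->
  chart_dom c x -> chart_dom d x -> chart_dom e x ->
  'J (to_coord e \o of_coord c) (to_coord c x) =
  'J (to_coord d \o of_coord c) (to_coord c x) *m
  'J (to_coord e \o of_coord d) (to_coord d x).
Proof.
move=> ac ad ae cx dx ex.
have cdx : (to_coord d \o of_coord c) (to_coord c x) = to_coord d x.
  by rewrite /= to_coordK.
rewrite -[in X in _ *m X]cdx.
apply: (@jacobian_chain _ _ _ (to_coord c @` (chart_dom c `&` chart_dom d))).
- exact/open_image_chart/open_chart_dom.
- by exists x.
- by move=> _ [y [cy dy] <-]; rewrite /= !to_coordK.
- exact: transition_differentiable.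
- by rewrite cdx; exact: transition_differentiable.
Qed.

Lemma transition_jacobian_id c x : chart_dom c x ->
  'J (to_coord c \o of_coord c) (to_coord c x) = 1%:M.
Proof.
move=> cx; apply: etrans (jacobian_id (to_coord c x)); apply/esym/near_eq_jacobian => //.
have : chart_cod c (to_coord c x) by exists x.
move=> cc; apply: filterS (nbhs_chart_cod cc).
by move=> _ [y cy <-]; rewrite /= to_coordK.
Qed.

(** The cocycle identity with the preferred chart at [x] as the intermediate one. *)
Lemma coord_frameM c d x : atlas c -> atlas d -> chart_dom c x -> chart_dom d x ->
  coord_frame c x *m tangent_coord d x =
  'J (to_coord d \o of_coord c) (to_coord c x).
Proof.
move=> ac ad cx dx; apply/esym/transition_jacobian => //.
  exact: chart_at_atlas.
exact: chart_at_dom.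
Qed.

Lemma coord_frameK c x : atlas c -> chart_dom c x ->
  coord_frame c x *m tangent_coord c x = 1%:M.
Proof. by move=> ac cx; rewrite (coord_frameM ac ac cx cx) transition_jacobian_id. Qed.

Lemma tangent_coordK c x : atlas c -> chart_dom c x ->
  tangent_coord c x *m coord_frame c x = 1%:M.
Proof. by move=> ac cx; apply: mulmx1C; exact: coord_frameK. Qed.

Lemma coord_frame_at x : coord_frame (chart_at x) x = 1%:M.
Proof. by apply: transition_jacobian_id; exact: chart_at_dom. Qed.

(** The field has constant components [e] in the chart [c], and in another chart [e] times a
    transition Jacobian. It supplies local fields with a prescribed value at a point. *)
Lemma smooth_coord_field c (e : 'rV[R]_n) : atlas c ->
  smooth_field (chart_dom c) (fun x => e *m coord_frame c x).
Proof.
move=> ac d ad; set A := to_coord d @` _.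
have oA : open A by exact/open_image_chart/open_chart_dom.
have oB : open (to_coord c @` (chart_dom c `&` chart_dom d)).
  exact/open_image_chart/open_chart_dom.
have sJ := smooth_on_jacobian oB (smooth_transition ac ad).
have : smooth_on A (fun u => e *m
    ('J (to_coord d \o of_coord c) ((to_coord c \o of_coord d) u))).
  apply: (smooth_on_mul oA (smooth_on_cst A e)).
  apply: (smooth_on_comp oA oB) (smooth_transition ad ac) sJ.
  by move=> _ [y [dy cy] <-]; exists y => //=; rewrite to_coordK.
move=> sh; apply: smooth_on_eq oA _ sh => _ [y [dy cy] <-].
by rewrite /= (to_coordK dy) -mulmxA (coord_frameM ac ad cy dy).
Qed.

Lemma smooth_field_subset (U U' : set N) (X : N -> 'rV[R]_n) :
  U `<=` U' -> smooth_field U' X -> smooth_field U X.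
Proof.
move=> UU sX c ac; apply: smooth_on_subset (sX c ac) => _ [x [cx Ux] <-].
by exists x => //; split=> //; exact: UU.
Qed.

(** In a chart, the components of [X A] are those of [X] times the matrix of [A], as the frame and
    coordinate matrices in the middle cancel. *)
Lemma smooth_field_endo (U : set N) (A : N -> 'M[R]_n) (X : N -> 'rV[R]_n) :
  open U -> smooth_endo A -> smooth_field U X ->
  smooth_field U (fun x => X x *m A x).
Proof.
move=> oU sA sX c ac; have oV := open_image_chart (c := c) oU.
have sAc : smooth_on (to_coord c @` (chart_dom c `&` U))
    ((fun x => coord_frame c x *m A x *m tangent_coord c x) \o of_coord c).
  by apply: smooth_on_subset (sA c ac) => _ [x [cx _] <-]; exists x.
apply: smooth_on_eq oV _ (smooth_on_mul oV (sX c ac) sAc) => _ [x [cx _] <-].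
have cancel_mid (T C B : 'M[R]_n) (v : 'rV[R]_n) : T *m C = 1%:M ->
    v *m T *m (C *m B *m T) = v *m B *m T.
  by move=> TC; rewrite -mulmxA !(mulmxA T) TC mul1mx mulmxA.
by rewrite /= (to_coordK cx); apply: cancel_mid; exact: tangent_coordK.
Qed.

Lemma smooth_field_scale U (h : N -> R) (X : N -> 'rV[R]_n) : open U ->
  smooth_fun U h -> smooth_field U X -> smooth_field U (fun x => h x *: X x).
Proof.
move=> oU sh sX c ac; have oV := open_image_chart (c := c) oU.
apply: smooth_on_eq oV _ (smooth_on_scale oV (sh c ac) (sX c ac)) => u _ /=.
by rewrite scalemxAl.
Qed.

(** The matrix of [A] in a chart is a conjugate of [A x], so it has the same determinant. *)
Lemma smooth_det_endo U (A : N -> 'M[R]_n) : open U -> smooth_endo A ->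
  smooth_fun U (fun x => \det (A x)).
Proof.
move=> oU sA c ac; have oV := open_image_chart (c := c) oU.
have sAc : smooth_on (to_coord c @` (chart_dom c `&` U))
    ((fun x => coord_frame c x *m A x *m tangent_coord c x) \o of_coord c).
  by apply: smooth_on_subset (sA c ac) => _ [x [cx _] <-]; exists x.
apply: smooth_on_eq oV _ (smooth_on_det oV sAc) => _ [x [cx _] <-].
rewrite /= (to_coordK cx) !det_mulmx mulrAC -det_mulmx.
by rewrite (coord_frameK ac cx) det1 mul1r.
Qed.

End Charts.

(** * The differential of a map read in arbitrary charts *)

Section LocalRepresentatives.
Variables (R : realType) (n m : nat) (N : manifold R n) (M : manifold R m).

Lemma local_rep_jacobian (f : N -> M) c d x : smooth_map f ->
  atlas c -> atlas d -> chart_dom c x -> chart_dom d (f x) ->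
  'J (to_coord d \o f \o of_coord c) (to_coord c x) =
  coord_frame c x *m dmap f x *m tangent_coord d (f x).
Proof.
move=> [cf sf] ac ad cx dfx.
have ofd (e : chart R m M) : open (f @^-1` chart_dom e).
  by apply: open_comp (open_chart_dom e) => y _; exact: cf.
have df (c' : chart R n N) (d' : chart R m M) : atlas c' -> atlas d' -> chart_dom c' x ->
    chart_dom d' (f x) ->
    differentiable (to_coord d' \o f \o of_coord c') (to_coord c' x).
  move=> ac' ad' cx' dx'; apply: smooth_on_differentiable (sf _ _ ac' ad') _.
  by exists x.
have ax := chart_at_dom x; have afx := chart_at_dom (f x).
have aax := chart_at_atlas x; have aafx := chart_at_atlas (f x).
have E1 : (to_coord (chart_at x) \o of_coord c) (to_coord c x) =
    to_coord (chart_at x) x by rewrite /= to_coordK.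
have E2 : (to_coord (chart_at (f x)) \o f \o of_coord (chart_at x))
    (to_coord (chart_at x) x) = to_coord (chart_at (f x)) (f x).
  by rewrite /= to_coordK.
have J1 : 'J (to_coord d \o f \o of_coord c) (to_coord c x) =
    coord_frame c x *m 'J (to_coord d \o f \o of_coord (chart_at x))
      (to_coord (chart_at x) x).
  rewrite -[in X in _ *m X]E1.
  apply: (@jacobian_chain _ _ _ _
      (to_coord c @` (chart_dom c `&` chart_dom (chart_at x)))).
  - exact/open_image_chart/open_chart_dom.
  - by exists x.
  - by move=> _ [y [cy xy] <-]; rewrite /= !to_coordK.
  - exact: transition_differentiable.
  - by rewrite E1; exact: df.
(* [J1] has replaced the chart of the source by the preferred one; a second use of the chain rule
   treats the chart of the target. *)
apply: etrans J1 _; rewrite -mulmxA; congr (_ *m _).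
rewrite /tangent_coord -E2.
apply: (@jacobian_chain _ _ _ _ (to_coord (chart_at x) @`
    (chart_dom (chart_at x) `&` f @^-1` chart_dom (chart_at (f x))))).
- exact: open_image_chart.
- by exists x.
- by move=> _ [y [cy xy] <-]; rewrite /= !to_coordK.
- exact: df.
- by rewrite E2; exact: transition_differentiable.
Qed.

End LocalRepresentatives.

(** * The tangential part of J *)

Section TangentialPart.
Variable R : realType.

Lemma delta_rV_neq0 n (i : 'I_n) : delta_mx 0 i != 0 :> 'rV[R]_n.
Proof.
apply/eqP => /rowP/(_ i); rewrite !mxE !eqxx /= => /eqP.
by rewrite oner_eq0.
Qed.

Lemma inner_inj n (A B : 'M[R]_n) :
  (forall u v, inner A u v = inner B u v) -> A = B.
Proof.
move=> AB; apply/matrixP => i j.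
have coef (C : 'M[R]_n) : inner C (delta_mx 0 i) (delta_mx 0 j) = C i j.
  by rewrite /inner trmx_delta -rowE -colE !mxE.
by rewrite -!coef AB.
Qed.

Lemma inner_mull n (G A : 'M[R]_n) u v : inner G (u *m A) v = inner (A *m G) u v.
Proof. by rewrite /inner !mulmxA. Qed.

Lemma innerDl n (G : 'M[R]_n) u v w : inner G (u + v) w = inner G u w + inner G v w.
Proof. by rewrite /inner !mulmxDl mxE. Qed.

Lemma innerZl n (G : 'M[R]_n) a u v : inner G (a *: u) v = a * inner G u v.
Proof. by rewrite /inner -!scalemxAl mxE. Qed.

Lemma innerNl n (G : 'M[R]_n) u v : inner G (- u) v = - inner G u v.
Proof. by rewrite -scaleN1r innerZl mulN1r. Qed.

(** A vector in the kernel of [G] has zero inner product with itself. *)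
Lemma inner_pos_unitmx n (G : 'M[R]_n) :
  (forall v, v != 0 -> 0 < inner G v v) -> G \in unitmx.
Proof.
move=> G0; rewrite -row_free_unit; apply: inj_row_free => v vG0.
apply/eqP; apply: contraT => /G0.
by rewrite /inner vG0 mul0mx mxE ltxx.
Qed.

(** Pairing the decomposition of [J X] with a tangent vector removes the normal part, so that [P] is
    determined by [g], [J], [gN] and the differential. *)
Lemma pullback_gram n m (g J : 'M[R]_m) (gN P : 'M[R]_n) (D F : 'M[R]_(n, m)) :
  (forall v w, inner g (v *m D) (w *m D) = inner gN v w) ->
  (forall v : 'rV_n, v *m D *m J = v *m P *m D + v *m F) ->
  (forall v w, inner g (v *m F) (w *m D) = 0) ->
  P *m gN = D *m J *m g *m D^T.
Proof.
move=> isom dec normal; apply: inner_inj => v w.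
rewrite -inner_mull -isom -[LHS]addr0 -(normal v w) -innerDl -dec.
by rewrite /inner trmx_mul !mulmxA.
Qed.

(** The previous formula after a change of bases: [C], [C'] stand for coordinate frames and [T],
    [T'] for their inverses, which cancel between consecutive factors. *)
Lemma pullback_gram_coord n m (C T : 'M[R]_n) (C' T' : 'M[R]_m)
    (g J : 'M[R]_m) (gN P : 'M[R]_n) (D : 'M[R]_(n, m)) :
  T *m C = 1%:M -> T' *m C' = 1%:M -> P *m gN = D *m J *m g *m D^T ->
  (C *m D *m T') *m (C' *m J *m T') *m (C' *m g *m C'^T) *m (C *m D *m T')^T =
  (C *m P *m T) *m (C *m gN *m C^T).
Proof.
move=> TC TC' PgN.
have -> : C *m P *m T *m (C *m gN *m C^T) = C *m (P *m gN) *m C^T.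
  by rewrite -!mulmxA (mulmxA T) TC mul1mx.
have CT' : C'^T *m T'^T = 1%:M by rewrite -trmx_mul TC' trmx1.
rewrite PgN !trmx_mul -!mulmxA; congr (_ *m (_ *m _)).
rewrite (mulmxA T') TC' mul1mx; congr (_ *m _).
rewrite (mulmxA T') TC' mul1mx; congr (_ *m _).
by rewrite (mulmxA C'^T) CT' mul1mx.
Qed.

Variables (n m : nat) (N : manifold R n) (M : manifold R m).
Variables (g J : M -> 'M[R]_m) (f : N -> M) (gN : N -> 'M[R]_n).
Variables (P : N -> 'M[R]_n) (F : N -> 'M[R]_(n, m)).

Lemma tangential_part_gram : isometric_immersion g f gN ->
  tangent_normal_decomposition g J f P F ->
  forall x, P x *m gN x = dmap f x *m J (f x) *m g (f x) *m (dmap f x)^T.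
Proof.
move=> [_ isom] dec x; apply: (@pullback_gram _ _ _ _ _ _ _ (F x)).
- by move=> v w; exact: isom.
- by move=> v; have [] := dec x v.
- by move=> v w; have [_] := dec x v; apply.
Qed.

(** Smoothness of [P] is derived: near each point, all factors of the Gram formula other than [P]
    are smooth in charts, and the one next to [P] is invertible. *)
Lemma tangential_part_smooth : almost_hermitian g J -> riemannian_metric gN ->
  isometric_immersion g f gN -> tangent_normal_decomposition g J f P F ->
  smooth_endo P.
Proof.
move=> [[sg _ _] [sJ _] _] [sgN _ gN0] isom dec c ac.
have PgN := tangential_part_gram isom dec.
have [[[cf sf] _] _] := isom.
apply: smooth_on_local => _ [x cx <-]; set d := chart_at (f x).
have ad : atlas d by exact: chart_at_atlas.
have ofd : open (f @^-1` chart_dom d).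
  by apply: open_comp (open_chart_dom d) => y _; exact: cf.
exists (to_coord c @` (chart_dom c `&` f @^-1` chart_dom d)).
  by exists x => //; split=> //; exact: chart_at_dom.
set A := to_coord c @` _; have oA : open A by exact: open_image_chart.
have sfA : smooth_on A (to_coord d \o f \o of_coord c) by exact: sf.
have Ad u : A u -> chart_cod d ((to_coord d \o f \o of_coord c) u).
  by move=> [y [cy dy] <-]; exists (f y) => //=; rewrite to_coordK.
have sD := smooth_on_jacobian oA sfA.
have od : open (chart_cod d) by exact: open_chart_cod.
have sJA := smooth_on_comp oA od Ad sfA (sJ d ad).
have sgA := smooth_on_comp oA od Ad sfA (sg d ad).
have sgNA : smooth_on A
    ((fun y => coord_frame c y *m gN y *m (coord_frame c y)^T) \o of_coord c).
  by apply: smooth_on_subset (sgN c ac) => _ [y [cy _] <-]; exists y.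
have gNunit u : A u ->
    ((fun y => coord_frame c y *m gN y *m (coord_frame c y)^T) \o of_coord c) u
      \in unitmx.
  move=> [y [cy _] <-]; rewrite /= (to_coordK cy).
  have [Cu _] := mulmx1_unit (coord_frameK ac cy).
  by rewrite !unitmx_mul unitmx_tr Cu inner_pos_unitmx//; exact: gN0.
(* This is the coordinate form of [D J g D^T] times the inverse of the Gram matrix of [gN]. *)
have sP := smooth_on_mul oA (smooth_on_mul oA (smooth_on_mul oA
  (smooth_on_mul oA sD sJA) sgA) (smooth_on_tr oA sD))
  (smooth_on_invmx oA gNunit sgNA).
apply: smooth_on_eq oA _ sP => u Au; have gu := gNunit u Au.
case: Au gu => y [cy dy] <- gu.
apply: (canLR (mulmxK gu)).
rewrite (local_rep_jacobian isom.1.1 ac ad cy dy) /= !(to_coordK cy) (to_coordK dy).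
apply: pullback_gram_coord; [exact: tangent_coordK|exact: tangent_coordK|exact: PgN].
Qed.

End TangentialPart.

(** * Functions with zero differential *)

Section ConstantFunctions.
Variables (R : realType).

Lemma derive_comp_vec (V W Z : normedModType R) (a : V -> W) (b : W -> Z) u v :
  differentiable a u -> differentiable b (a u) ->
  'D_v (b \o a) u = 'D_('D_v a u) b (a u).
Proof.
move=> da db; have dba := differentiable_comp da db.
apply: etrans (deriveE v dba) (etrans _ (esym (deriveE _ db))).
by rewrite (deriveE v da) (diff_comp da db).
Qed.

(** The mean value theorem on [[0, 1]] for the restriction of [H] to the segment from [x] to [y]. *)
Lemma derive_eq0_cst (V : normedModType R) (H : V -> R^o) (x y : V) :
  (forall t : R, 0 <= t <= 1 -> differentiable H (x + t *: (y - x))) ->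
  (forall t : R, 0 <= t <= 1 -> forall v, 'D_v H (x + t *: (y - x)) = 0) ->
  H y = H x.
Proof.
move=> dH DH; pose line (t : R^o) := x + t *: (y - x).
have dl (t : R^o) : differentiable line t.
  apply: differentiableD; first exact: differentiable_cst.
  exact: differentiableZl.
have Dphi (t : R) : 0 <= t <= 1 -> is_derive (t : R^o) (1 : R^o) (H \o line) 0.
  move=> t01; split.
    by apply/diff_derivable/differentiable_comp => //; exact: dH.
  by rewrite derive_comp_vec//; [exact: DH|exact: dH].
have [t||t t01] := @MVT_segment R (H \o line) (cst 0) 0 1 ler01.
- rewrite in_itv /= => /andP[t0 t1].
  by apply: Dphi; rewrite !ltW.
- apply: derivable_within_continuous => t; rewrite in_itv /= => t01.
  by have [] := Dphi t t01.
- rewrite mul0r /line /= scale1r scale0r addr0 (addrC x) subrK => /eqP.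
  by rewrite subr_eq0 => /eqP.
Qed.

Variables (n : nat) (N : manifold R n).

Lemma dir_derive_cst (k : R) (y : N) v : dir_derive (fun _ => k) y v = 0.
Proof. exact: derive_cst. Qed.

Lemma smooth_fun_differentiable (h : N -> R) (c : chart R n N) y :
  smooth_fun setT h -> atlas c -> chart_dom c y ->
  differentiable (h \o of_coord c : _ -> R^o) (to_coord c y).
Proof.
by move=> sh ac cy; apply: smooth_on_differentiable (sh c ac) _; exists y.
Qed.

(** [dir_derive] at [y] refers to the preferred chart at [y], which changes with [y]; this brings it
    to a fixed chart, where segments can be followed. *)
Lemma derive_chart (h : N -> R) (c : chart R n N) y v :
  smooth_fun setT h -> atlas c -> chart_dom c y ->
  'D_v (h \o of_coord c : _ -> R^o) (to_coord c y) =
  dir_derive h y (v *m coord_frame c y).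
Proof.
move=> sh ac cy; set d := chart_at y.
have ad : atlas d by exact: chart_at_atlas.
have dy : chart_dom d y by exact: chart_at_dom.
have dt := transition_differentiable ac ad cy dy.
have cdy : (to_coord d \o of_coord c) (to_coord c y) = to_coord d y.
  by rewrite /= to_coordK.
have dh := smooth_fun_differentiable sh ad dy.
have dhc : differentiable (h \o of_coord d : _ -> R^o)
    ((to_coord d \o of_coord c) (to_coord c y)) by rewrite cdy.
rewrite /dir_derive -/d -(deriveEjacobian _ dt) -cdy.
apply: etrans _ (derive_comp_vec v dt dhc); apply: near_eq_derive.
have nA : nbhs (to_coord c y) (to_coord c @` (chart_dom c `&` chart_dom d)).
  apply: open_nbhs_nbhs; split; first exact/open_image_chart/open_chart_dom.
  by exists y.
by apply: filterS nA => _ [z [cz dz] <-]; rewrite /= !to_coordK.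
Qed.

Lemma dir_derive_eq0_locally_cst (h : N -> R) : smooth_fun setT h ->
  (forall x v, dir_derive h x v = 0) -> forall x, \forall y \near x, h y = h x.
Proof.
move=> sh Dh x; set c := chart_at x.
have ac : atlas c by exact: chart_at_atlas.
have cx : chart_dom c x by exact: chart_at_dom.
have /nbhs_ballP[e /= e0 xe] : nbhs (to_coord c x) (chart_cod c).
  by apply: nbhs_chart_cod; exists x.
have nc : nbhs x (chart_dom c).
  by apply: open_nbhs_nbhs; split=> //; exact: open_chart_dom.
have nb : \forall y \near x, ball (to_coord c x) e (to_coord c y).
  by apply: (continuous_to_coord cx); exact: nbhsx_ballx.
apply: filterS2 nc nb => y cy xey.
(* Balls of the coordinate space are convex, so the segment stays in [chart_cod c] and each of its
   points comes from the manifold. *)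
have segment (t : R) : 0 <= t <= 1 ->
    exists2 z, chart_dom c z &
      to_coord c z = to_coord c x + t *: (to_coord c y - to_coord c x).
  move=> /andP[t0 t1].
  suff /xe[z cz zE] : ball (to_coord c x) e
      (to_coord c x + t *: (to_coord c y - to_coord c x)) by exists z.
  move: xey; rewrite -!ball_normE /ball_ /= opprD addNKr normrN normrZ ger0_norm//.
  by rewrite distrC; apply: le_lt_trans; rewrite ler_piMl.
have := @derive_eq0_cst _ (h \o of_coord c) (to_coord c x) (to_coord c y).
rewrite /= !to_coordK//; apply=> t /segment[z cz <-].
- exact: smooth_fun_differentiable.
- by move=> v; rewrite derive_chart.
Qed.

Lemma dir_derive_eq0_cst (h : N -> R) : smooth_fun setT h ->
  (forall x v, dir_derive h x v = 0) -> forall x y, h x = h y.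
Proof.
move=> sh Dh x y; have hloc := dir_derive_eq0_locally_cst sh Dh.
(* Local constancy makes every such preimage open; taking [Q] to be equality to [h y] and then its
   negation shows that the level set is open and closed. *)
have oB (Q : R -> Prop) : open [set z | Q (h z)].
  rewrite openE => z Qz; apply: filterS (hloc z) => w; rewrite /= => ->.
  exact: Qz.
suff : [set z | h z = h y] = [set: N].
  by move=> /seteqP[_ /(_ x)]; apply.
apply: manifold_connected.
- by exists y.
- by exists [set z | h z = h y]; rewrite ?setTI//; exact: (oB (fun r => r = h y)).
- exists [set z | h z = h y]; rewrite ?setTI// -openC.
  exact: (oB (fun r => r <> h y)).
Qed.

End ConstantFunctions.

(** * Skew endomorphisms of a plane and angles *)

Section InnerProducts.
Variables (R : realType) (n : nat) (G : 'M[R]_n).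
Hypotheses (Gsym : G^T = G) (Gpos : forall v, v != 0 -> 0 < inner G v v).

Lemma innerC u v : inner G u v = inner G v u.
Proof. by rewrite /inner -[u *m _ *m _]trmxK mxE !trmx_mul Gsym trmxK mulmxA. Qed.

Lemma innerDr u v w : inner G u (v + w) = inner G u v + inner G u w.
Proof. by rewrite !(innerC u) innerDl. Qed.

Lemma innerZr a u v : inner G u (a *: v) = a * inner G u v.
Proof. by rewrite !(innerC u) innerZl. Qed.

Lemma inner0l v : inner G 0 v = 0.
Proof. by rewrite /inner !mul0mx mxE. Qed.

Lemma inner_ge0 v : 0 <= inner G v v.
Proof. by have [->|/Gpos/ltW//] := eqVneq v 0; rewrite inner0l. Qed.

Lemma inner_norm_gt0 v : v != 0 -> 0 < inner_norm G v.
Proof. by move=> /Gpos; rewrite sqrtr_gt0. Qed.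

Lemma sqr_inner_norm v : inner_norm G v ^+ 2 = inner G v v.
Proof. by rewrite sqr_sqrtr// inner_ge0. Qed.

Lemma cauchy_schwarz u v : `|inner G u v| <= inner_norm G u * inner_norm G v.
Proof.
have [->|v0] := eqVneq v 0.
  by rewrite innerC inner0l normr0 mulr_ge0// sqrtr_ge0.
rewrite -sqrtrM ?inner_ge0// -sqrtr_sqr ler_wsqrtr//.
(* With [c = <v, v>], the square of this vector is [c] times the defect in the squared inequality,
   and [c] is positive. *)
have := inner_ge0 (inner G v v *: u - inner G u v *: v).
rewrite -scaleNr !innerDl !innerDr !innerZl !innerZr (innerC v u).
set a := inner G u u; set b := inner G u v; have := Gpos v0; set c := inner G v v.
move=> c0; rewrite [X in 0 <= X](_ : _ = c * (a * c - b ^+ 2)); last by ring.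
by rewrite pmulr_rge0// subr_ge0.
Qed.

End InnerProducts.

(** * Skew endomorphisms of a Euclidean plane *)

Section SkewEndomorphisms.
Variables (R : realType).

Lemma ord2P (P : 'I_2 -> Prop) : P 0 -> P 1 -> forall i, P i.
Proof.
move=> P0 P1 [[|[|//]] i2]; first by rewrite (_ : Ordinal _ = 0)//; exact: val_inj.
by rewrite (_ : Ordinal _ = 1)//; exact: val_inj.
Qed.

Lemma sum_ord2 (V : nmodType) (h : 'I_2 -> V) : \sum_i h i = h 0 + h 1.
Proof.
by rewrite big_ord_recl big_ord1; congr (_ + h _); exact: val_inj.
Qed.

Lemma det_mx22 (A : 'M[R]_2) : \det A = A 0 0 * A 1 1 - A 0 1 * A 1 0.
Proof.
rewrite (expand_det_row _ 0) sum_ord2 /cofactor !det_mx11 !mxE.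
have -> : lift 0 0 = 1 :> 'I_2 by exact: val_inj.
have -> : lift 1 0 = 0 :> 'I_2 by exact: val_inj.
by rewrite /= addn0 expr0 expr1 mul1r mulN1r mulrN.
Qed.

(** The Cayley-Hamilton identity in dimension two, without its trace term. *)
Lemma sqr_mx22_trace0 (A : 'M[R]_2) : \tr A = 0 -> A *m A = - (\det A)%:M.
Proof.
rewrite /mxtrace det_mx22 sum_ord2.
move=> /eqP; rewrite addr_eq0 => /eqP trA.
apply/matrixP => i j; rewrite !mxE sum_ord2.
by elim/ord2P: i; elim/ord2P: j; rewrite /= ?mulr1n ?mulr0n ?trA; ring.
Qed.

Variables (G A : 'M[R]_2).
Hypotheses (Gsym : G^T = G) (Gpos : forall v, v != 0 -> 0 < inner G v v).
Hypothesis skewA : forall u, inner G (u *m A) u = 0.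

(** Polarisation of [skewA] at [u + v]. *)
Lemma inner_skew u v : inner G (u *m A) v = - inner G u (v *m A).
Proof.
have := skewA (u + v).
rewrite mulmxDl !innerDl !innerDr// !skewA add0r addr0 => /eqP.
by rewrite addr_eq0 => /eqP ->; rewrite innerC.
Qed.

(** By skewness [A *m G] is antisymmetric; its entrywise relations combine into [tr A * det G = 0],
    and [G] is invertible. *)
Lemma skew_trace0 : \tr A = 0.
Proof.
have S : A *m G = - (A *m G)^T.
  apply: inner_inj => u v; rewrite -inner_mull inner_skew (innerC Gsym) inner_mull.
  rewrite /inner mulmxN mulNmx [RHS]mxE; congr (- _).
  by rewrite -[u *m _ *m _]trmxK [RHS]mxE !trmx_mul !trmxK !mulmxA.
have : \det G != 0 by have := inner_pos_unitmx Gpos; rewrite unitmxE unitfE.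
have G10 : G 1 0 = G 0 1 by rewrite -[in LHS]Gsym mxE.
have entry i j : A i 0 * G 0 j + A i 1 * G 1 j = - (A j 0 * G 0 i + A j 1 * G 1 i).
  by have /matrixP/(_ i j) := S; rewrite !mxE !sum_ord2.
have := entry 0 0; have := entry 1 1; have := entry 0 1.
rewrite det_mx22 /mxtrace sum_ord2 G10.
set a := A 0 0; set b := A 0 1; set c := A 1 0; set d := A 1 1.
set p := G 0 0; set q := G 0 1; set r := G 1 1 => E01 E11 E00 /mulIf; apply.
rewrite mul0r.
have ap : a * p = - (b * q) by lra.
have dr : d * r = - (c * q) by lra.
(* The factor [q] turns the off-diagonal relation into the products that remain in
   [tr A * det G]. *)
have : q * (a * q + b * r) = - (q * (c * p + d * q)) by rewrite E01 mulrN.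
move=> E.
have -> : (a + d) * (p * r - q * q) = (a * p) * r + (d * r) * p - (a + d) * (q * q).
  by ring.
by rewrite ap dr; lra.
Qed.

(** Moving one [A] across gives [- <u A^2, v>], and [A^2 = - det A] because the trace vanishes. *)
Lemma inner_skew_image u v : inner G (u *m A) (v *m A) = \det A * inner G u v.
Proof.
rewrite -[LHS]opprK -inner_skew -mulmxA (sqr_mx22_trace0 skew_trace0).
by rewrite mulmxN mul_mx_scalar -scaleNr innerZl mulNr opprK.
Qed.

End SkewEndomorphisms.

(** * The Wirtinger angle of a surface, computed at one point *)

Section Angles.
Variables (R : realType).

Lemma acos_le (x y : R) : -1 <= x -> x <= y -> y <= 1 -> acos y <= acos x.
Proof.
move=> x1 xy y1; have xI : -1 <= x <= 1 by rewrite x1 (le_trans xy).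
have yI : -1 <= y <= 1 by rewrite y1 (le_trans x1).
rewrite leNgt -ltr_cos ?in_itv/= ?acos_ge0 ?acos_lepi//.
by rewrite !acosK ?in_itv//= -leNgt.
Qed.

Lemma inf_min (S : set R) a : S a -> lbound S a -> inf S = a.
Proof.
move=> Sa aS; apply/eqP; rewrite eq_le; apply/andP; split.
  by apply: ge_inf => //; exists a.
by apply: lb_le_inf => //; exists a.
Qed.

Variables (m : nat) (g J : 'M[R]_m) (G P : 'M[R]_2) (D F : 'M[R]_(2, m)).
Hypotheses (gsym : g^T = g) (gpos : forall v, v != 0 -> 0 < inner g v v).
Hypothesis J2 : J *m J = - 1%:M.
Hypothesis Jisom : forall u v, inner g (u *m J) (v *m J) = inner g u v.
Hypotheses (Gsym : G^T = G) (Gpos : forall v, v != 0 -> 0 < inner G v v).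
Hypothesis isom : forall v w, inner g (v *m D) (w *m D) = inner G v w.
Hypothesis dec : forall v : 'rV_2, v *m D *m J = v *m P *m D + v *m F.
Hypothesis normal : forall v w, inner g (v *m F) (w *m D) = 0.

Lemma tangential_part_inner v w :
  inner g (v *m D *m J) (w *m D) = inner G (v *m P) w.
Proof. by rewrite dec innerDl isom normal addr0. Qed.

(** Applying the isometry [J] to both arguments gives [<Ju, u> = <JJu, Ju> = - <u, Ju>], so this
    number is its own opposite. *)
Lemma tangential_part_skew v : inner G (v *m P) v = 0.
Proof.
rewrite -tangential_part_inner; set u := v *m D.
have : inner g (u *m J) u = - inner g (u *m J) u.
  rewrite -[LHS]Jisom -mulmxA J2 mulmxN mulmx1 -scaleN1r innerZl mulN1r.
  by rewrite (innerC gsym).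
by lra.
Qed.

Lemma tangential_part_image v w :
  inner G (v *m P) (w *m P) = \det P * inner G v w.
Proof. exact: inner_skew_image Gsym Gpos tangential_part_skew v w. Qed.

Lemma tangential_part_norm v : inner_norm G (v *m P) = Num.sqrt (\det P) * inner_norm G v.
Proof.
rewrite /inner_norm tangential_part_image mulrC sqrtrM ?inner_ge0//.
by rewrite mulrC.
Qed.

(** Cauchy-Schwarz gives [|PX|^2 = <JX, PX> <= |X| |PX|]; then [|PX|] is cancelled when it is
    nonzero. *)
Lemma tangential_part_norm_le v : inner_norm G (v *m P) <= inner_norm G v.
Proof.
have [->|vP0] := eqVneq (v *m P) 0.
  by rewrite /inner_norm inner0l sqrtr0 sqrtr_ge0.
rewrite -(ler_pM2r (inner_norm_gt0 Gpos vP0)) -expr2 sqr_inner_norm//.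
rewrite -tangential_part_inner; apply: le_trans (ler_norm _) _.
apply: le_trans (cauchy_schwarz gsym gpos _ _) _.
by rewrite /inner_norm Jisom !isom.
Qed.

Lemma det_tangential_part_itv : 0 <= \det P <= 1.
Proof.
pose e : 'rV[R]_2 := delta_mx 0 0.
have e0 : e != 0 by exact: delta_rV_neq0.
have dP : 0 <= \det P.
  rewrite -(pmulr_lge0 _ (Gpos e0)) -tangential_part_image.
  exact: inner_ge0.
have := tangential_part_norm_le e; rewrite tangential_part_norm.
rewrite ger_pMl; last exact: inner_norm_gt0.
by rewrite dP -[X in _ -> (_ && (X <= _))](sqr_sqrtr dP) expr_le1// sqrtr_ge0.
Qed.

Lemma sqrt_det_itv : 0 <= Num.sqrt (\det P) <= 1.
Proof.
by rewrite sqrtr_ge0 -[X in _ <= X]sqrtr1 ler_wsqrtr//; have /andP[] := det_tangential_part_itv.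
Qed.

(** The least angle is attained at the orthogonal projection [PX] of [JX], where the cosine is
    [|PX| / |X|]; Cauchy-Schwarz shows that no tangent vector does better. *)
Lemma angle_subspaceE v : v != 0 ->
  angle_subspace g (v *m D *m J) D = acos (Num.sqrt (\det P)).
Proof.
move=> v0; set l := Num.sqrt _.
have nv : 0 < inner_norm G v by exact: inner_norm_gt0.
have vangleE w : vangle g (v *m D *m J) (w *m D) =
    acos (inner G (v *m P) w / (inner_norm G v * inner_norm G w)).
  by rewrite /vangle tangential_part_inner /inner_norm Jisom !isom.
have D0 (w : 'rV[R]_2) : w != 0 -> w *m D != 0.
  move=> w0; have := Gpos w0; rewrite -isom; apply: contraTneq => ->.
  by rewrite inner0l ltxx.
apply: inf_min.
(* If [PX = 0], then [JX] is orthogonal to the whole tangent plane and any nonzero vector attains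
   the right angle; [v] is one. *)
- pose w := if v *m P == 0 then v else v *m P.
  have w0 : w != 0 by rewrite /w; case: ifPn.
  exists (w *m D); first by split; [exact: submxMl|exact: D0].
  rewrite vangleE /w; congr acos; case: ifPn => [/eqP vP|vP].
    have := tangential_part_norm v; rewrite vP inner0l mul0r /inner_norm inner0l sqrtr0.
    by move=> /esym/eqP; rewrite mulf_eq0 (gt_eqF nv) orbF => /eqP.
  rewrite -(sqr_inner_norm Gpos) expr2 -mulf_div divff ?gt_eqF ?inner_norm_gt0//.
  by rewrite mulr1 tangential_part_norm mulfK// gt_eqF.
- move=> _ [w' [/submxP[w ->]] wD0 <-]; rewrite vangleE.
  have w0 : w != 0 by apply: contraNneq wD0 => ->; rewrite mul0mx.
  have nw : 0 < inner_norm G w by exact: inner_norm_gt0.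
  have /andP[l0 l1] := sqrt_det_itv.
  (* The absolute value also bounds the cosine below by [- l >= -1], which puts it in the range
     where [acos] is decreasing. *)
  have : `|inner G (v *m P) w / (inner_norm G v * inner_norm G w)| <= l.
    rewrite normrM normfV (ger0_norm (ltW (mulr_gt0 nv nw))).
    rewrite ler_pdivrMr ?mulr_gt0// mulrA -tangential_part_norm.
    exact: cauchy_schwarz.
  rewrite ler_norml => /andP[xl lx]; apply: acos_le => //.
  by apply: le_trans xl; rewrite lerN2.
Qed.

End Angles.

(** * The covariant derivative of P *)

Section SlantSurfaces.
Variables (R : realType) (N : manifold R 2) (gN : N -> 'M[R]_2).
Hypothesis hN : riemannian_metric gN.
Variable nabla : (N -> 'rV[R]_2) -> N -> 'rV[R]_2 -> 'rV[R]_2.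
Hypothesis hnabla : levi_civita gN nabla.
Variable P : N -> 'M[R]_2.
Hypothesis sP : smooth_endo P.
Hypothesis skewP : forall x u, inner (gN x) (u *m P x) u = 0.

Let gN_sym x : (gN x)^T = gN x. Proof. by have [_ + _] := hN; apply. Qed.
Let gN_pos x v : v != 0 -> 0 < inner (gN x) v v.
Proof. by have [_ _ +] := hN; apply. Qed.

Lemma inner_skew_endo x u v :
  inner (gN x) (u *m P x) (v *m P x) = \det (P x) * inner (gN x) u v.
Proof. exact: (inner_skew_image (gN_sym x) (gN_pos x) (skewP x)). Qed.

(** The first coordinate field of the preferred chart at [x], whose value at [x] is the first basis
    vector. *)
Lemma local_nonvanishing_field x : exists U (Y : N -> 'rV[R]_2),
  [/\ open U, U x, smooth_field U Y & Y x != 0].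
Proof.
have ac := chart_at_atlas x; have cx := chart_at_dom x.
exists (chart_dom (chart_at x)), (fun y => delta_mx 0 0 *m coord_frame (chart_at x) y).
split=> //; [exact: open_chart_dom|exact: smooth_coord_field|].
by rewrite coord_frame_at mulmx1 delta_rV_neq0.
Qed.

(* Differentiate <PY, PY> = (det P) <Y, Y> along v in two ways. *)
Lemma nabla_endo_image U Y x v : open U -> smooth_field U Y -> U x ->
  2 * inner (gN x) (nabla_endo nabla P x v Y) (Y x *m P x) =
  dir_derive (fun y => \det (P y)) x v * inner (gN x) (Y x) (Y x).
Proof.
move=> oU sY Ux; have sPY := smooth_field_endo oU sP sY.
have sh := smooth_det_endo oU sP.
have shY := smooth_field_scale oU sh sY.
have := nabla_metric hnabla oU sPY sPY Ux v.
(* The factor [det P] is absorbed into the field [(det P) Y], so that metric compatibility and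
   Leibniz's rule for [nabla] give the second expression of the derivative. *)
rewrite (_ : (fun y => inner _ _ _) =
    fun y => inner (gN y) (\det (P y) *: Y y) (Y y)); last first.
  by apply/funext => y; rewrite inner_skew_endo innerZl.
rewrite (nabla_metric hnabla oU shY sY Ux v).
rewrite (nabla_leibniz hnabla oU sh sY Ux v) /nabla_endo.
set A := nabla (fun y => Y y *m P y) x v; set B := nabla Y x v.
rewrite (innerC (gN_sym x) (Y x *m P x) A) (innerC (gN_sym x) (_ *: Y x) B).
rewrite !innerDl innerNl !innerZl (innerZr (gN_sym x)) inner_skew_endo => E.
by lra.
Qed.

(* Differentiate <PY, Y> = 0 along v. *)
Lemma nabla_endo_orthogonal U Y x v : open U -> smooth_field U Y -> U x ->
  inner (gN x) (nabla_endo nabla P x v Y) (Y x) = 0.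
Proof.
move=> oU sY Ux; have sPY := smooth_field_endo oU sP sY.
have := nabla_metric hnabla oU sPY sY Ux v.
rewrite (_ : (fun y => inner _ _ _) = fun=> 0); last first.
  by apply/funext => y; rewrite skewP.
rewrite dir_derive_cst => /esym E.
rewrite /nabla_endo innerDl innerNl.
rewrite (inner_skew (gN_sym x) (skewP x)) opprK.
by rewrite (innerC (gN_sym x) (nabla Y x v)).
Qed.

Lemma parallel_det_cst : parallel nabla P ->
  forall x y, \det (P x) = \det (P y).
Proof.
move=> parP; apply: (dir_derive_eq0_cst (smooth_det_endo openT sP)) => x v.
have [U [Y [oU Ux sY Yx]]] := local_nonvanishing_field x.
have := nabla_endo_image v oU sY Ux.
rewrite (parP U Y x oU sY Ux v) inner0l mulr0 => /esym/eqP.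
by rewrite mulf_eq0 (gt_eqF (gN_pos x Yx)) orbF => /eqP.
Qed.

(** [u] and [u P] are orthogonal by skewness, and [u P] is nonzero because [det P] is, so they form
    a basis of the plane; positivity of the metric concludes. *)
Lemma orthogonal_skew_eq0 x u w : \det (P x) != 0 -> u != 0 ->
  inner (gN x) w u = 0 -> inner (gN x) w (u *m P x) = 0 -> w = 0.
Proof.
move=> d0 u0 wu wPu; have nu := gt_eqF (gN_pos x u0 : 0 < inner (gN x) u u).
pose K : 'M[R]_2 := col_mx u (u *m P x).
have Ku : K \in unitmx.
  (* A relation [s u + t (u P) = 0] is paired with [u] to get [s = 0], then with [u P] to get
     [t = 0]. *)
  rewrite -row_free_unit; apply: inj_row_free => v.
  rewrite -[v](@hsubmxK _ 1 1 1) /K (@mul_row_col _ 1 1 1 2).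
  rewrite [lsubmx _]mx11_scalar [rsubmx _]mx11_scalar !mul_scalar_mx.
  set s := lsubmx _ _ _; set t := rsubmx _ _ _ => E.
  have s0 : s = 0.
    have := congr1 (fun z => inner (gN x) z u) E.
    rewrite innerDl !innerZl skewP inner0l mulr0 addr0 => /eqP.
    by rewrite mulf_eq0 nu orbF => /eqP.
  have t0 : t = 0.
    have := congr1 (fun z => inner (gN x) z (u *m P x)) E.
    rewrite s0 scale0r add0r innerZl inner_skew_endo inner0l => /eqP.
    by rewrite !mulf_eq0 nu (negbTE d0) !orbF => /eqP.
  by rewrite s0 t0 !raddf0 (@row_mx0 _ 1 1 1).
(* The two orthogonality hypotheses, gathered into one product with an invertible matrix. *)
have : w *m (gN x *m K^T) = 0.
  rewrite mulmxA /K (@tr_col_mx _ 1 1 2) (@mul_mx_row _ 1 2 1 1).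
  rewrite [X in row_mx X _]mx11_scalar [X in row_mx _ X]mx11_scalar.
  move: wu wPu; rewrite /inner => -> ->.
  by rewrite raddf0 (@row_mx0 _ 1 1 1).
have Uu : gN x *m K^T \in unitmx.
  by rewrite unitmx_mul unitmx_tr Ku inner_pos_unitmx//; exact: gN_pos.
by move=> /(congr1 (mulmxr (invmx (gN x *m K^T)))); rewrite /= mulmxK// mul0mx.
Qed.

Lemma det_cst_parallel k : k != 0 -> (forall x, \det (P x) = k) ->
  parallel nabla P.
Proof.
move=> k0 detP.
have nonvanishing U Y x v : open U -> smooth_field U Y -> U x -> Y x != 0 ->
    nabla_endo nabla P x v Y = 0.
  move=> oU sY Ux Yx; apply: (orthogonal_skew_eq0 (x := x) _ Yx).
  - by rewrite detP.
  - exact: nabla_endo_orthogonal sY Ux.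
  - have := nabla_endo_image v oU sY Ux.
    rewrite (_ : (fun y => _) = fun=> k); last exact/funext.
    by rewrite dir_derive_cst mul0r => /eqP; rewrite mulf_eq0 pnatr_eq0 => /eqP.
move=> U Y x oU sY Ux v; have [Yx|Yx] := eqVneq (Y x) 0; last exact: (nonvanishing U).
(* At a zero of [Y], both [Z] and [Y + Z] are nonzero, so the claim for [Y] follows by additivity.
   The fields are restricted to [V], where both are smooth. *)
have [U' [Z [oU' U'x sZ Zx]]] := local_nonvanishing_field x.
pose V := U `&` U'; have oV : open V by exact: openI.
have Vx : V x by [].
have sYV := smooth_field_subset (@subIsetl _ U U') sY.
have sZV := smooth_field_subset (@subIsetr _ U U') sZ.
have sYZ : smooth_field V (fun y => Y y + Z y).
  move=> c ac k'; have oA := open_image_chart (c := c) oV.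
  have := Ck_onD oA (sYV c ac k') (sZV c ac k').
  by apply: Ck_on_ext => u /=; rewrite mulmxDl.
have YZx : Y x + Z x != 0 by rewrite Yx add0r.
have := nonvanishing _ _ _ v oV sYZ Vx YZx.
rewrite /nabla_endo (nablaD hnabla oV sYV sZV Vx) mulmxDl.
rewrite (_ : (fun y => _) = fun y => Y y *m P y + Z y *m P y); last first.
  by apply/funext => y; rewrite mulmxDl.
rewrite (nablaD hnabla oV (smooth_field_endo oV sP sYV) (smooth_field_endo oV sP sZV) Vx).
have /eqP := nonvanishing _ _ _ v oV sZV Vx Zx.
by rewrite /nabla_endo subr_eq0 => /eqP ->; rewrite opprD addrACA subrr addr0.
Qed.

End SlantSurfaces.

Theorem theorem3p4 (R : realType) (m : nat)
    (M : manifold R m) (g J : M -> 'M[R]_m)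
    (hM : almost_hermitian g J)
    (N : manifold R 2) (gN : N -> 'M[R]_2) (hN : riemannian_metric gN)
    (f : N -> M) (hf : isometric_immersion g f gN)
    (nabla : (N -> 'rV[R]_2) -> N -> 'rV[R]_2 -> 'rV[R]_2)
    (hnabla : levi_civita gN nabla)
    (P : N -> 'M[R]_2) (F : N -> 'M[R]_(2, m))
    (hPF : tangent_normal_decomposition g J f P F) :
  ((~ totally_real g J f /\ ~ complex_submanifold g J f /\ parallel nabla P)
     <-> kaehlerian_slant g J f nabla P) /\
  (kaehlerian_slant g J f nabla P <-> proper_slant g J f).
Proof.
have sP := tangential_part_smooth hM hN hf hPF.
have [[_ gsym gpos] [_ J2] Jisom] := hM; have [_ gNsym gNpos] := hN.
have [_ isom] := hf.
have dec x (v : 'rV_2) :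
    v *m dmap f x *m J (f x) = v *m P x *m dmap f x + v *m F x.
  by have [] := hPF x v.
have normal x v w : inner (g (f x)) (v *m F x) (w *m dmap f x) = 0.
  by have [_] := hPF x v; apply.
have skewP x u : inner (gN x) (u *m P x) u = 0.
  exact: (tangential_part_skew (gsym _) (J2 _) (Jisom _) (isom x) (dec x) (normal x)).
have angleE x v : v != 0 ->
    wirtinger_angle g J f x v = acos (Num.sqrt (\det (P x))).
  move=> v0; exact: (angle_subspaceE (gsym _) (gpos _) (J2 _) (Jisom _)
    (gNsym x) (gNpos x) (isom x) (dec x) (normal x) v0).
have det01 x : 0 <= \det (P x) <= 1.
  exact: (det_tangential_part_itv (gsym _) (gpos _) (J2 _) (Jisom _)
    (gNsym x) (gNpos x) (isom x) (dec x) (normal x)).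
(* Once unfolded, the three statements differ only by slantness and parallelism; this claim and
   [slant_parallel] supply each from the other. *)
have parallel_slant : parallel nabla P -> slant g J f.
  move=> parP; have detP := parallel_det_cst hN hnabla sP skewP parP.
  have [[x0 _]|N0] := pselect (exists x : N, True); last first.
    (* A connected space may be empty here; then any angle, for instance 0, serves. *)
    by exists 0 => x; case: N0; exists x.
  exists (acos (Num.sqrt (\det (P x0)))) => x v v0.
  by rewrite angleE// (detP x x0).
have slant_parallel : slant g J f -> ~ totally_real g J f -> parallel nabla P.
  move=> [theta slantN] ntr.
  pose e : 'rV[R]_2 := delta_mx 0 0.
  have e0 : e != 0 by exact: delta_rV_neq0.
  (* The constant is recovered by inverting [theta = acos (sqrt (det P))], which is legitimate since
     [det P] lies in [[0, 1]]. *)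
  have detP x : \det (P x) = cos theta ^+ 2.
    have /andP[d0 d1] := det01 x.
    rewrite -(slantN x e e0) angleE// acosK ?sqr_sqrtr//.
    rewrite in_itv /= (le_trans _ (sqrtr_ge0 _)) ?lerN10//=.
    by rewrite -[X in _ <= X]sqrtr1 ler_wsqrtr.
  apply: (det_cst_parallel hN hnabla sP skewP _ detP).
  (* If the constant were 0, every angle would be [acos 0 = pi / 2], and the surface would be
     totally real. *)
  apply/eqP => c0; apply: ntr => x v v0.
  by rewrite angleE// detP c0 sqrtr0 acos0.
split; split.
- move=> [ntr [ncp parP]]; split=> //; split=> //; exact: parallel_slant.
- by move=> [[_ ncp ntr] parP].
- by move=> [].
- by move=> ps; split=> //; have [s _ ntr] := ps; exact: slant_parallel.
Qed.
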